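(* For any isolated reduced point $P\in M^T$ with $\mathrm{vd}\,P=0$, we have $$n_P^\Lambda\equiv\dim\mathrm{coker}(p_\Lambda\circ a|_P)^f\pmod 2,$$ where $p_\Lambda\colon E|_P\to\Lambda|_P$ is the projection for any splitting $E|_P=\Lambda|_P\oplus\Lambda^\vee|_P$.
   Context: $M$ is a quasi-projective complex scheme with an action of an algebraic torus $T$ and a $T$-equivariant, $T$-equivariantly symmetric 3-term obstruction theory $E^\bullet\to\tau^{\ge-1}\mathbb L_M$ coming from a $(-2)$-shifted derived scheme, represented by a $T$-equivariant self-dual complex $$[F\xrightarrow{a}E\cong E^\vee\xrightarrow{a^\vee}F^\vee]$$ in degrees $-2,-1,0$, where $F$ is a vector bundle and $(E,q)$ is a quadratic vector bundle of even rank (non-degenerate symmetric form). $\Lambda\subset E$ is a $T$-equivariant maximal isotropic subbundle. The fixed locus $M^T$ is assumed 0-dimensional and reduced. For $P\in M^T$, $(-)^f$ denotes the $T$-fixed part; then $[F|_P^f\xrightarrow{a}E|_P^f\cong (E|_P^f)^\vee\to(F|_P^f)^\vee]$ is a 3-term symmetric obstruction theory of the reduced point $P$, so $a\colon F|_P^f\to E|_P^f$ is injective with isotropic image. Its virtual dimension is $\mathrm{vd}\,P=\dim F|_P^f-\frac12\dim E|_P^f\le0$, and $\mathrm{vd}\,P=0$ iff $a(F|_P^f)\subset E|_P^f$ is maximal isotropic. $\Lambda|_P^f\subset E|_P^f$ is maximal isotropic. A maximal isotropic subspace of an even-dimensional quadratic vector space induces an orientation of it; two maximal isotropic subspaces $\Lambda_1,\Lambda_2$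 of a quadratic space of dimension $2l$ induce the same orientation if and only if $\dim(\Lambda_1\cap\Lambda_2)\equiv l\pmod2$. For $P$ with $\mathrm{vd}\,P=0$, $n_P^\Lambda\in\mathbb Z/2$ is defined by: $(-1)^{n_P^\Lambda}=1$ if $a(F|_P^f)$ is positively oriented, i.e. induces on $E|_P^f$ the same orientation as $\Lambda|_P^f$, and $(-1)^{n_P^\Lambda}=-1$ otherwise. The splitting $E|_P=\Lambda|_P\oplus\Lambda^\vee|_P$ is a ($T$-equivariant) splitting into maximal isotropic subspaces. *)

(* Defs.v *)
From HB Require Import structures.
From mathcomp Require Import all_boot all_order all_algebra.
From mathcomp Require Import boolp classical_sets reals.
From mathcomp Require Import complex.

Set Implicit Arguments.
Unset Strict Implicit.
Unset Printing Implicit Defensive.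

Import Order.TTheory GRing.Theory Num.Theory.
Local Open Scope ring_scope.

(** * Algebraic tori over the complex numbers R[i] and their representations *)

(* The group (C^* )^r, as a subset of the functions from 'I_r to C, under
   pointwise multiplication. *)
Definition torus (R : realType) (r : nat) : {pred {ffun 'I_r -> R[i]}} :=
  [pred t : {ffun 'I_r -> R[i]} | [forall i, t i != 0]].
Arguments torus : clear implicits.

(* The last field says that the matrix entries of the action are Laurent
   polynomials in the coordinates of t, i.e. that the action is a morphism of
   algebraic groups.  The value of the action outside [torus] is irrelevant. *)
Record torus_rep (R : realType) (r : nat) (V : vectType R[i]) := TorusRep {
  tact :> {ffun 'I_r -> R[i]} -> 'End(V);
  tact1 : tact [ffun=> 1] = \1%VF;
  tactM : {in torus R r &, forall s t : {ffun 'I_r -> R[i]},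
    tact [ffun i => s i * t i] = (tact s \o tact t)%VF};
  tact_alg : exists (X : seq {ffun 'I_r -> int})
                    (A : {ffun 'I_r -> int} -> 'End(V)),
    {in torus R r, forall t : {ffun 'I_r -> R[i]},
      tact t = \sum_(x <- X) (\prod_i t i ^ x i) *: A x}
}.

Definition tstable (R : realType) (r : nat) (V : vectType R[i])
    (rho : torus_rep r V) (U : {vspace V}) : Prop :=
  {in torus R r, forall t, (rho t @: U <= U)%VS}.

Definition tequivariant (R : realType) (r : nat) (V W : vectType R[i])
    (rhoV : torus_rep r V) (rhoW : torus_rep r W) (f : 'Hom(V, W)) : Prop :=
  {in torus R r, forall t, (f \o rhoV t = rhoW t \o f)%VF}.

Definition fixed_mod_pred (R : realType) (r : nat) (V : vectType R[i])
    (rho : torus_rep r V) (U I : {vspace V}) (v : V) : Prop :=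
  v \in U /\ {in torus R r, forall t, rho t v - v \in I}.

(* For T-stable subspaces I <= U, this is the preimage in U of the T-fixed
   part of the quotient representation U / I.  See [mem_fixed_mod]. *)
Definition fixed_mod (R : realType) (r : nat) (V : vectType R[i])
    (rho : torus_rep r V) (U I : {vspace V}) : {vspace V} :=
  xget 0%VS [set W : {vspace V} | forall v, v \in W <-> fixed_mod_pred rho U I v].

Definition fixed (R : realType) (r : nat) (V : vectType R[i])
    (rho : torus_rep r V) (U : {vspace V}) : {vspace V} :=
  fixed_mod rho U 0%VS.

Lemma linear_pred_vspace (K : fieldType) (V : vectType K) (P : V -> Prop) :
  P 0 -> (forall c u v, P u -> P v -> P (c *: u + v)) ->
  exists W : {vspace V}, forall v, v \in W <-> P v.
Proof.
move=> P0 PD.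
have ext n (W : {vspace V}) : (\dim {:V} - \dim W <= n)%N ->
    (forall v, v \in W -> P v) -> exists W : {vspace V}, forall v, v \in W <-> P v.
  elim: n W => [|n IHn] W leWn WP.
    exists W => v; split; first exact: WP.
    suff -> : W = fullv by rewrite memvf.
    by apply/eqP; rewrite eqEdim subvf -subn_eq0 -leqn0.
  case: (pselect (exists2 v, P v & v \notin W)) => [[v Pv vW]|noext]; last first.
    exists W => v; split; first exact: WP.
    by move=> Pv; apply/negPn/negP => vW; apply: noext; exists v.
  apply: (IHn (<[v]> + W)%VS) => [|_ /memv_addP[_ /vlineP[c ->] [w wW ->]]].
    have ltW : (\dim W < \dim (<[v]> + W))%N.
      rewrite ltnNge; apply/negP => le_dim; case/negP: vW.
      have /eqP -> : W == (<[v]> + W)%VS by rewrite eqEdim addvSr.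
      by rewrite memvE addvSl.
    rewrite leq_subLR in leWn; rewrite leq_subLR (leq_trans leWn) // addnS -addSn.
    by rewrite leq_add2r.
  exact: PD (WP _ wW).
by apply: (ext _ 0%VS (leqnn _)) => v; rewrite memv0 => /eqP->.
Qed.

Lemma mem_fixed_mod (R : realType) (r : nat) (V : vectType R[i])
    (rho : torus_rep r V) (U I : {vspace V}) (v : V) :
  v \in fixed_mod rho U I <->
  v \in U /\ {in torus R r, forall t, rho t v - v \in I}.
Proof.
rewrite /fixed_mod; case: xgetP => [W _ /(_ v) //|noW].
have [||W WP] := @linear_pred_vspace _ _ (fixed_mod_pred rho U I).
- by split=> [|t _]; [exact: mem0v | rewrite linear0 subr0; exact: mem0v].
- move=> c u w [uU uI] [wU wI]; split=> [|t tT]; first by rewrite memvD ?memvZ.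
  rewrite linearD linearZ opprD addrACA -scalerBr.
  by rewrite memvD ?memvZ ?uI ?wI.
by case: (noW W).
Qed.

Lemma mem_fixed (R : realType) (r : nat) (V : vectType R[i])
    (rho : torus_rep r V) (U : {vspace V}) (v : V) :
  v \in fixed rho U <-> v \in U /\ {in torus R r, forall t, rho t v = v}.
Proof.
rewrite mem_fixed_mod; split=> -[vU vI]; split=> // t /vI.
  by rewrite memv0 subr_eq0 => /eqP.
by move=> ->; rewrite subrr mem0v.
Qed.

(* The dimension of coker(f)^T, for f an equivariant map into V with image
   contained in the T-stable subspace U, regarded as a map to U. *)
Definition dim_coker_fixed (R : realType) (r : nat) (W V : vectType R[i])
    (rho : torus_rep r V) (U : {vspace V}) (f : 'Hom(W, V)) : nat :=
  (\dim (fixed_mod rho U (limg f)) - \dim (limg f))%N.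

(** * Quadratic spaces, maximal isotropic subspaces and orientations *)

Definition isotropic (K : fieldType) (E : vectType K) (q : {symmetric E})
    (L : {vspace E}) : Prop := (L <= orthov q L)%VS.

Definition max_isotropic (K : fieldType) (E : vectType K) (q : {symmetric E})
    (U L : {vspace E}) : Prop :=
  [/\ (L <= U)%VS, isotropic q L &
      forall L' : {vspace E}, (L' <= U)%VS -> isotropic q L' ->
        (L <= L')%VS -> L' = L].

(* The wedge product s_0 /\ s_1 /\ ... in the line det U, for a sequence s of
   \dim U vectors of U; the line is identified with K by [vbasis U]. *)
Definition top_wedge (K : fieldType) (E : vectType K) (U : {vspace E})
    (s : seq E) : K :=
  \det (\matrix_(i < \dim U, j < \dim U) coord (vbasis U) j s`_i).

(* An orientation of a quadratic space U of dimension 2l is an element o of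
   det U with q(o, o) = (-1)^l.  The one induced by a maximal isotropic L comes
   from 0 -> L -> U -> L^* -> 0, i.e. from det U = det L (x) det L^*: it is
   e_1 /\ ... /\ e_l /\ f_1 /\ ... /\ f_l for any basis e of L and any vectors f
   of U lifting the dual basis of e.  Conventions for this isomorphism differ by
   a sign depending only on l, which does not affect [same_orientation]. *)
Definition induces_orientation (K : fieldType) (E : vectType K)
    (q : {symmetric E}) (U L : {vspace E}) (o : K) : Prop :=
  exists e f : seq E,
    [/\ basis_of L e, size f = size e, {subset f <= U},
        forall i j : 'I_(size e), q e`_i f`_j = (i == j)%:R &
        o = top_wedge U (e ++ f)].

Definition same_orientation (K : fieldType) (E : vectType K)
    (q : {symmetric E}) (U L1 L2 : {vspace E}) : Prop :=
  exists2 o, induces_orientation q U L1 o & induces_orientation q U L2 o.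

(** * Symmetric complexes F -> E = E^* -> F^* *)

(* The composite of F -> E with its dual E = E^* -> F^*, e |-> q(e, a(-)), is
   zero. *)
Definition is_sym_complex (K : fieldType) (F E : vectType K)
    (q : {symmetric E}) (a : 'Hom(F, E)) : Prop :=
  forall x y : F, q (a x) (a y) = 0.

(* The symmetric complex [Ff -> Ef -> Ff^*] in degrees -2, -1, 0 is an
   obstruction theory of a reduced point.  The truncated cotangent complex of
   the point is 0, so the condition is h^0 = 0: every functional on Ff is of the
   form q(e, a(-)) with e in Ef. *)
Definition point_obstruction_theory (K : fieldType) (F E : vectType K)
    (q : {symmetric E}) (a : 'Hom(F, E))
    (Ff : {vspace F}) (Ef : {vspace E}) : Prop :=
  [/\ (a @: Ff <= Ef)%VS, {in Ff &, forall x y, q (a x) (a y) = 0} &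
      forall phi : 'Hom(F, K^o),
        exists2 e, e \in Ef & {in Ff, forall x, q e (a x) = phi x}].

Definition virtual_dim (K : fieldType) (F E : vectType K)
    (Ff : {vspace F}) (Ef : {vspace E}) : rat :=
  (\dim Ff)%:R - (\dim Ef)%:R / 2%:R.

(* The element n of Z/2 such that (-1)^n = 1 if A and L induce the same
   orientation of U, and (-1)^n = -1 otherwise. *)
Definition orientation_parity (K : fieldType) (E : vectType K)
    (q : {symmetric E}) (U L A : {vspace E}) : 'Z_2 :=
  if `[< same_orientation q U A L >] then 0 else 1.

(* Main.v *)
Require Import Defs.
From HB Require Import structures.
From mathcomp Require Import all_boot all_order all_algebra.
From mathcomp Require Import boolp classical_sets reals.
From mathcomp Require Import complex.

Set Implicit Arguments.
Unset Strict Implicit.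
Unset Printing Implicit Defensive.

Import Order.TTheory GRing.Theory Num.Theory.
Local Open Scope ring_scope.

(** Everything takes place in the fixed part W = E^f.  The torus T is linearly
reductive, so taking T-fixed parts is exact: E^f is a non-degenerate quadratic
space, it is the direct sum of the isotropic subspaces L^f and N^f, and the
fixed part of the cokernel of p_L o a is the cokernel of the map
p_L : A -> L^f, where A = a(F^f) ([dim_coker_fixedE]).  Non-degeneracy forces
dim L^f = dim N^f = l, and the vanishing of the virtual dimension together with
the injectivity of a on F^f ([obstruction_theory_inj]) gives dim A = l.  Hence
the cokernel has the dimension of the kernel of p_L on A, which is the
intersection of A and N^f, and it remains to see that A and L^f induce the same
orientation exactly when this intersection has even dimension
([same_orientationP]).

For this, choose a basis e0 of L^f and the dual basis f0 in N^f.  A basis e of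
A, completed by any vectors f with q(e_i, f_j) = delta_ij, is obtained from
e0 ++ f0 by a matrix with blocks X, Y, Z, U.  That A is isotropic and that f is
dual to e say X Y^T + Y X^T = 0 and X U^T + Y Z^T = 1, and these two identities
alone imply that the determinant is (-1)^(l - rank X) ([det_isotropic_block]).
Since X is the matrix of p_L on A, the exponent is the dimension of the
intersection of A and N^f.  The case A = L^f shows at the same time that the
orientation induced by L^f does not depend on the choices.

Reductivity is obtained from an explicit Reynolds operator: a linear
combination of finitely many operators of the representation, with coefficients
of total mass 1, which kills every non-trivial character that occurs
([exists_reynolds]).  Being built from the action itself, it commutes with
equivariant maps, preserves stable subspaces and is compatible with invariant
forms. *)

(** * Determinants of isometries of hyperbolic spaces *)

Section IsotropicBlocks.
Variable K : fieldType.

(** When X is invertible the Schur complement of X turns out to be X^-T, so the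
two factors of the determinant cancel. *)
Lemma det_isotropic_block_unit (l : nat) (X Y Z U : 'M[K]_l) :
  X \in unitmx -> X *m Y^T + Y *m X^T = 0 -> X *m U^T + Y *m Z^T = 1%:M ->
  \det (block_mx X Y Z U) = 1.
Proof.
move=> Xu XY XU.
have schur : U - Z *m invmx X *m Y = (invmx X)^T.
  apply: trmx_inj; rewrite trmxK linearB /= !trmx_mul.
  apply: (can_inj (mulKmx Xu)); rewrite mulmxBr mulmxV // !mulmxA.
  move/eqP: XY; rewrite addr_eq0 => /eqP->.
  by rewrite !mulNmx opprK -(mulmxA Y) -trmx_mul mulVmx // trmx1 mulmx1.
have := congr1 determinant (mulmx_block X Y Z U (invmx X) (- (invmx X *m Y)) 0 1%:M).
rewrite !mulmxN !mulmxA !mulmx0 !mulmx1 mulmxV // mul1mx !addr0 addNr.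
rewrite [- _ + U]addrC schur det_mulmx det_ublock det_lblock !det1 mul1r mulr1.
rewrite det_tr det_inv => /(congr1 ( *%R^~ (\det X))).
by rewrite mulfVK ?mulVf // -unitfE -unitmxE.
Qed.

(** The isometry that exchanges e_i and f_i for the l - r indices i >= r is a
product of l - r reflections; this is where the sign comes from. *)
Lemma det_partial_swap (l r : nat) : (r <= l)%N ->
  \det (block_mx (pid_mx r) (copid_mx r) (copid_mx r) (pid_mx r) : 'M[K]_(l + l))
  = (-1) ^+ (l - r).
Proof.
move=> le_rl; set D := pid_mx r; set D' := copid_mx r.
(* Adding the second block row to the first, and then subtracting the first
   block column from the second, leaves the diagonal block D - D'. *)
have DD' : D + D' = 1%:M by rewrite addrC subrK.
have := congr1 determinant (mulmx_block 1%:M 1%:M 0 1%:M D D' D' D).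
rewrite !mul1mx !mul0mx !add0r [D' + D]addrC DD' det_mulmx det_ublock.
rewrite det1 !mul1r => ->.
have := congr1 determinant (mulmx_block 1%:M 1%:M D' D 1%:M (- 1%:M) 0 1%:M).
rewrite !mulmx1 !mulmx0 !addr0 !mulmxN !mulmx1 [- 1%:M + _]addNr det_mulmx det_ublock.
rewrite !det1 !mulr1 => ->.
rewrite det_lblock det1 mul1r.
have -> : - D' + D = diag_mx (\row_i (if (i < r)%N then 1 else -1)).
  apply/matrixP => i j; rewrite !mxE.
  rewrite -!val_eqE /=; case: eqP => [eq_ij|_] /=; last by rewrite subr0 oppr0 addr0.
  by rewrite !eq_ij; case: (j < r)%N; rewrite ?subrr ?subr0 ?oppr0 ?add0r ?addr0.
rewrite det_diag; under eq_bigr => i _ do rewrite mxE.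
rewrite -(big_mkord xpredT (fun i => if (i < r)%N then 1 else -1 : K)).
rewrite (big_cat_nat (leq0n r) le_rl) /= big_nat big1 => [|i /andP[_ ->] //].
rewrite mul1r big_nat; under eq_bigr => i /andP[le_ri _] do rewrite ltnNge le_ri /=.
by rewrite -big_nat prodr_const_nat.
Qed.

(** After the exchange of e_i and f_i for i >= r, the first block becomes
X + Y X', with X' the complement of the projector X.  It is invertible: a vector
killed by it is killed by X and Y, hence by X U^T + Y Z^T = 1.  This reduces to
an invertible first block, at the cost of the sign of the exchange. *)
Lemma det_isotropic_block_pid (l r : nat) (Y Z U : 'M[K]_l) (X := pid_mx r) : (r <= l)%N ->
  X *m Y^T + Y *m X^T = 0 -> X *m U^T + Y *m Z^T = 1%:M ->
  \det (block_mx X Y Z U) = (-1) ^+ (l - r).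
Proof.
move=> le_rl XY XU; pose X' : 'M[K]_l := copid_mx r.
have XX1 : X *m X = X by rewrite pid_mx_id.
have XX'0 : X *m X' = 0 by rewrite mul_pid_mx_copid.
have X'X0 : X' *m X = 0 by rewrite mul_copid_mx_pid.
have X'X'1 : X' *m X' = X' by rewrite copid_mx_id.
have XX n (M : 'M_(l, n)) : X *m (X *m M) = X *m M by rewrite mulmxA XX1.
have XX' n (M : 'M_(l, n)) : X *m (X' *m M) = 0 by rewrite mulmxA XX'0 mul0mx.
have X'X n (M : 'M_(l, n)) : X' *m (X *m M) = 0 by rewrite mulmxA X'X0 mul0mx.
have X'X' n (M : 'M_(l, n)) : X' *m (X' *m M) = X' *m M by rewrite mulmxA X'X'1.
have DX n (M : 'M_(l, n)) : X' *m M + X *m M = M.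
  by rewrite -mulmxDl subrK mul1mx.
have trX : X^T = X by rewrite tr_pid_mx.
have trX' : X'^T = X' by rewrite linearB /= trmx1 tr_pid_mx.
have simp := (linearD, trmx_mul, trX, trX', mulmxDl, mulmxDr, =^~ mulmxA).
have swap : \det (block_mx X X' X' X) = (-1) ^+ (l - r) by exact: det_partial_swap.
have X'E : 1%:M = X' + X by rewrite subrK.
clearbody X X'.
have := congr1 determinant (mulmx_block X Y Z U X X' X' X).
rewrite det_mulmx swap.
rewrite (@det_isotropic_block_unit _ (X *m X + Y *m X')) => [|||].
- have sq : (-1) ^+ (l - r) * (-1) ^+ (l - r) = 1 :> K by rewrite -expr2 sqrr_sign.
  by move=> detB; rewrite -[LHS]mulr1 -[X in _ * X = _]sq mulrA detB mul1r.
- rewrite -row_free_unit; apply: inj_row_free => v.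
  rewrite mulmxDr !mulmxA => vX'.
  have vX : v *m X = 0.
    have := congr1 (mulmx^~ X) vX'.
    by rewrite mulmxDl -!mulmxA X'X0 !mulmx0 addr0 !XX1 mul0mx.
  have vYX' : v *m Y *m X' = 0.
    by move: vX'; rewrite vX mul0mx add0r.
  have vYX : v *m Y *m X = 0.
    have := congr1 (mulmx v) XY.
    by rewrite trX mulmx0 mulmxDr !mulmxA vX mul0mx add0r.
  have vY : v *m Y = 0.
    by rewrite -[LHS]mulmx1 X'E mulmxDr vYX vYX' addr0.
  by rewrite -[LHS]mulmx1 -XU mulmxDr !mulmxA vX vY !mul0mx addr0.
- rewrite !simp /= !simp /=.
  rewrite !(XX, XX', X'X, X'X', XX1, X'X0, XX'0, X'X'1, mulmx0, addr0, add0r).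
  by rewrite -[RHS]XY trX.
- rewrite !simp /= !simp /=.
  rewrite !(XX, XX', X'X, X'X', XX1, X'X0, XX'0, X'X'1, mulmx0, addr0, add0r).
  by rewrite -addrA -mulmxDr DX.
Qed.

(** The rows (X, Y) span an isotropic subspace of the hyperbolic space and the
rows (Z, U) are dual to them.  Changing the basis of the subspace by g and that
of the ambient space by h, and the dual bases contragrediently, leaves both
hypotheses and the determinant unchanged, so X may be taken to be the partial
identity of the same rank. *)
Lemma det_isotropic_block (l : nat) (X Y Z U : 'M[K]_l) :
  X *m Y^T + Y *m X^T = 0 -> X *m U^T + Y *m Z^T = 1%:M ->
  \det (block_mx X Y Z U) = (-1) ^+ (l - \rank X).
Proof.
move=> XY XU; pose g := col_ebase X; pose h := row_ebase X; pose r := \rank X.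
have gu : g \in unitmx by exact: col_ebase_unit.
have hu : h \in unitmx by exact: row_ebase_unit.
have defX : X = g *m pid_mx r *m h by rewrite mulmx_ebase.
pose Y1 := invmx g *m Y *m h^T; pose Z1 := g^T *m Z *m invmx h; pose U1 := g^T *m U *m h^T.
have hhT : h^T *m (invmx h)^T = 1%:M by rewrite -trmx_mul mulVmx ?trmx1.
have ggT : (invmx g)^T *m g^T = 1%:M by rewrite -trmx_mul mulmxV ?trmx1.
have defY : Y = g *m Y1 *m (invmx h)^T.
  by rewrite /Y1 !mulmxA mulmxV // mul1mx -mulmxA hhT mulmx1.
have defZ : Z = (invmx g)^T *m Z1 *m h.
  by rewrite /Z1 !mulmxA ggT mul1mx mulmxKV.
have defU : U = (invmx g)^T *m U1 *m (invmx h)^T.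
  by rewrite /U1 !mulmxA ggT mul1mx -mulmxA hhT mulmx1.
have -> : block_mx X Y Z U = block_mx g 0 0 (invmx g)^T
    *m block_mx (pid_mx r) Y1 Z1 U1 *m block_mx h 0 0 (invmx h)^T.
  by rewrite !mulmx_block !mul0mx !mulmx0 !addr0 !add0r -defX -defY -defZ -defU.
have detV (m : 'M[K]_l) : m \in unitmx -> \det m * (\det m)^-1 = 1.
  by move=> mu; rewrite mulfV // -unitfE -unitmxE.
rewrite !det_mulmx !det_ublock !det_tr !det_inv !detV // mul1r mulr1.
have defpid : pid_mx r = invmx g *m X *m invmx h.
  by rewrite [in RHS]defX !mulmxA mulVmx // mul1mx mulmxK.
apply: det_isotropic_block_pid; rewrite ?rank_leq_row // defpid.
  rewrite !trmx_mul trmxK !mulmxA mulmxKV // -(mulmxA _ h^T) hhT mulmx1.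
  by rewrite -mulmxDl -!(mulmxA (invmx g)) -mulmxDr XY mulmx0 mul0mx.
rewrite !trmx_mul !trmxK !mulmxA mulmxKV // -(mulmxA _ h^T) hhT mulmx1.
by rewrite -mulmxDl -!(mulmxA (invmx g)) -mulmxDr XU mulmx1 mulVmx.
Qed.
End IsotropicBlocks.

(** * Families of vectors and their coordinates *)

Section Families.
Variables (K : fieldType) (E : vectType K).

Definition lincomb (m n : nat) (B : 'M[K]_(m, n)) (b : n.-tuple E) : m.-tuple E :=
  [tuple \sum_j B i j *: b`_j | i < m].

Lemma nth_lincomb (m n : nat) (B : 'M[K]_(m, n)) (b : n.-tuple E) (i : 'I_m) :
  (lincomb B b)`_i = \sum_j B i j *: b`_j.
Proof. by rewrite -tnth_nth tnth_mktuple. Qed.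

Lemma eq_from_nth_ord (n : nat) (s t : n.-tuple E) :
  (forall i : 'I_n, s`_i = t`_i) -> s = t.
Proof. by move=> st; apply: eq_from_tnth => i; rewrite !(tnth_nth 0). Qed.

Lemma lincomb_coord (m n : nat) (s : m.-tuple E) (b : n.-tuple E) :
  {subset s <= <<b>>%VS} -> s = lincomb (\matrix_(i, j) coord b j s`_i) b.
Proof.
move=> sb; apply: eq_from_nth_ord => i; rewrite nth_lincomb.
rewrite [LHS](coord_span (sb _ (mem_nth _ _))) ?size_tuple //.
by apply: eq_bigr => j _; rewrite mxE.
Qed.

Lemma lincomb_mul (m n p : nat) (C : 'M[K]_(m, n)) (B : 'M[K]_(n, p)) (b : p.-tuple E) :
  lincomb C (lincomb B b) = lincomb (C *m B) b.
Proof.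
apply: eq_from_nth_ord => i; rewrite !nth_lincomb.
under eq_bigr => j _ do rewrite nth_lincomb scaler_sumr.
rewrite exchange_big; apply: eq_bigr => k _; rewrite mxE scaler_suml.
by apply: eq_bigr => j _; rewrite scalerA.
Qed.

Lemma span_lincomb_sub (m n : nat) (C : 'M[K]_(m, n)) (b : n.-tuple E) :
  (<<lincomb C b>> <= <<b>>)%VS.
Proof.
apply/span_subvP => _ /tnthP[i ->]; rewrite (tnth_nth 0) nth_lincomb.
by apply: memv_suml => j _; rewrite memvZ // memv_span // mem_nth ?size_tuple.
Qed.

Lemma free_rowP {n : nat} {b : n.-tuple E} :
  reflect (forall u : 'rV_n, \sum_i u 0 i *: b`_i = 0 -> u = 0) (free b).
Proof.
apply: (iffP freeP) => [b_free u /b_free u0|b_free k k0 i].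
  by apply/rowP => i; rewrite u0 mxE.
have /rowP/(_ i) : \row_i k i = 0; last by rewrite !mxE.
by apply: b_free; rewrite -[RHS]k0; apply: eq_bigr => j _; rewrite mxE.
Qed.

Lemma sum_lincomb (m n : nat) (B : 'M[K]_(m, n)) (b : n.-tuple E) (u : 'rV_m) :
  \sum_i u 0 i *: (lincomb B b)`_i = \sum_j (u *m B) 0 j *: b`_j.
Proof.
under eq_bigr => i _ do rewrite nth_lincomb scaler_sumr.
rewrite exchange_big; apply: eq_bigr => j _; rewrite mxE scaler_suml.
by apply: eq_bigr => i _; rewrite scalerA.
Qed.

Lemma free_lincomb (m n : nat) (B : 'M[K]_(m, n)) (b : n.-tuple E) :
  free b -> free (lincomb B b) = row_free B.
Proof.
move=> /free_rowP b_free; apply/free_rowP/idP => [c_free|B_free u].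
  apply: inj_row_free => u uB; apply: c_free; rewrite sum_lincomb uB.
  by rewrite big1 // => j _; rewrite mxE scale0r.
rewrite sum_lincomb => /b_free uB; apply: (row_free_inj B_free).
by rewrite uB mul0mx.
Qed.

(** A row base of B has the same row space as B, and independent rows. *)
Lemma dim_span_lincomb (m n : nat) (B : 'M[K]_(m, n)) (b : n.-tuple E) :
  free b -> \dim <<lincomb B b>> = \rank B.
Proof.
move=> b_free.
have /submxP[D defR] : (row_base B <= B)%MS by rewrite eq_row_base.
have -> : <<lincomb B b>>%VS = <<lincomb (row_base B) b>>%VS.
  apply/eqP; rewrite eqEsubv -{1}(mulmx_base B) -lincomb_mul span_lincomb_sub.
  by rewrite defR -lincomb_mul span_lincomb_sub.
apply/eqP; rewrite -[X in _ == X](size_tuple (lincomb (row_base B) b)).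
by rewrite -/(free _) free_lincomb ?row_base_free.
Qed.

Lemma top_wedge_lincomb (W : {vspace E}) (n : nat) (B : 'M[K]_n) (b : n.-tuple E) :
  \dim W = n -> top_wedge W (lincomb B b) = \det B * top_wedge W b.
Proof.
move=> dimW; case: n / dimW B b => B b; rewrite -det_mulmx; congr (\det _).
apply/matrixP => i j; rewrite !mxE nth_lincomb linear_sum /=.
by apply: eq_bigr => k _; rewrite linearZ mxE.
Qed.

Lemma top_wedge_neq0 (W : {vspace E}) (n : nat) (b : n.-tuple E) :
  basis_of W b -> top_wedge W b != 0.
Proof.
move=> b_basis; have dimW := size_basis b_basis.
case: n / dimW b b_basis => b b_basis.
rewrite /top_wedge -unitfE -[_ \in _]unitmxE -row_free_unit.
rewrite -(free_lincomb _ (basis_free (vbasisP W))) -lincomb_coord ?(basis_free b_basis) //.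
by move=> v /(basis_mem b_basis); rewrite (span_basis (vbasisP W)).
Qed.

Variable q : {symmetric E}.

Definition gram (m n : nat) (s : m.-tuple E) (t : n.-tuple E) : 'M[K]_(m, n) :=
  \matrix_(i, j) q s`_i t`_j.

Lemma gram_lincomb (m n m' n' : nat) (B : 'M[K]_(m, n)) (b : n.-tuple E)
    (C : 'M[K]_(m', n')) (c : n'.-tuple E) :
  gram (lincomb B b) (lincomb C c) = B *m gram b c *m C^T.
Proof.
apply/matrixP => i j; rewrite !mxE !nth_lincomb linear_sumr /=.
apply: eq_bigr => k _; rewrite linearZr_LR /= linear_sumlz !mxE mulrC; congr (_ * _).
by apply: eq_bigr => h _; rewrite linearZl_LR mxE.
Qed.

Lemma gram_cat (l : nat) (e f e' f' : l.-tuple E) :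
  gram [tuple of e ++ f] [tuple of e' ++ f'] =
  block_mx (gram e e') (gram e f') (gram f e') (gram f f').
Proof.
have nthl (s t : l.-tuple E) (i : 'I_l) : (s ++ t)`_(lshift l i) = s`_i.
  by rewrite nth_cat size_tuple /= ltn_ord.
have nthr (s t : l.-tuple E) (i : 'I_l) : (s ++ t)`_(rshift l i) = t`_i.
  by rewrite nth_cat size_tuple /= ltnNge leq_addr addKn.
apply/matrixP => i j; rewrite -(splitK i) -(splitK j).
case: (split i) (split j) => i' [] j' /=;
  by rewrite ?(block_mxEul, block_mxEur, block_mxEdl, block_mxEdr) !mxE ?nthl ?nthr.
Qed.

Lemma gram_sym (m n : nat) (s : m.-tuple E) (t : n.-tuple E) :
  gram t s = (gram s t)^T.
Proof. by apply/matrixP => i j; rewrite !mxE [LHS]hermC mul1r. Qed.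

(** A linear relation between the s_i is one between the rows of the matrix. *)
Lemma free_gram (m n : nat) (s : m.-tuple E) (t : n.-tuple E) :
  row_free (gram s t) -> free s.
Proof.
move=> st_free; apply/free_rowP => u us; apply: (row_free_inj st_free).
apply/rowP => j; rewrite mul0mx !mxE.
have := congr1 (fun v => q v t`_j) us; rewrite linear0l linear_sumlz => us_j.
rewrite -[RHS]us_j; apply: eq_bigr => h _.
by rewrite !mxE linearZl_LR.
Qed.

(** Stated with vectors rather than with a form on a subtype, as the subspace
varies while the form stays on the ambient space. *)
Definition nondegenerate_on (W : {vspace E}) : Prop :=
  forall w, w \in W -> {in W, forall v, q w v = 0} -> w = 0.

(** With C the coordinates of e and G the invertible Gram matrix of a basis of W,
the product C G has independent rows; a right inverse of it gives the
coordinates of the dual family. *)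
Lemma exists_dual (W : {vspace E}) (m : nat) (e : m.-tuple E) :
  nondegenerate_on W -> {subset e <= W} -> free e ->
  exists2 f : m.-tuple E, {subset f <= W} & gram e f = 1%:M.
Proof.
move=> W_nondeg eW e_free.
pose b := vbasis W; have b_basis : basis_of W b := vbasisP W.
have bW : <<b>>%VS = W := span_basis b_basis.
have b_free := basis_free b_basis.
have G_free : row_free (gram b b).
  apply: inj_row_free => u uG; pose w := \sum_i u 0 i *: b`_i.
  apply: (elimT free_rowP b_free); apply: W_nondeg => [|v vW].
    apply: memv_suml => i _; rewrite memvZ // (basis_mem b_basis) //.
    by rewrite mem_nth ?size_tuple.
  rewrite (coord_basis b_basis vW) linear_sumr big1 // => j _.
  rewrite linearZr_LR linear_sumlz /=.
  have /rowP/(_ j) := uG; rewrite !mxE => uG_j.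
  rewrite -[X in _ * X = _](_ : 0 = _) ?mulr0 // -[LHS]uG_j.
  by apply: eq_bigr => i _; rewrite mxE linearZl_LR.
have [C defe] : exists C, e = lincomb C b.
  by exists (\matrix_(i, j) coord b j e`_i); apply: lincomb_coord; rewrite bW.
have C_free : row_free C by rewrite -(free_lincomb _ b_free) -defe.
have CG_free : row_free (C *m gram b b).
  by rewrite /row_free mxrankMfree.
exists (lincomb (pinvmx (C *m gram b b))^T b).
  by move=> v /memv_span /(subvP (span_lincomb_sub _ _)); rewrite bW.
by rewrite {1}defe gram_lincomb trmxK mulmxVp.
Qed.
End Families.

(** * Orientations induced by isotropic subspaces *)

Section HyperbolicSpaces.
Variables (K : fieldType) (E : vectType K).
Variable q : {symmetric E}.

(** Tuples fix the common length of e and f, so that e ++ f has coordinates in a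
block matrix. *)
Lemma induces_orientationP (U L : {vspace E}) (o : K) (l : nat) : \dim L = l ->
  induces_orientation q U L o <->
  exists e f : l.-tuple E, [/\ basis_of L e, {subset f <= U},
    gram q e f = 1%:M & o = top_wedge U (e ++ f)].
Proof.
move=> dimL; split=> [[e [f [e_basis szf fU ef ->]]]|[e [f [e_basis fU ef ->]]]].
  have sze : size e == l.
    by rewrite -(eqP (basis_free e_basis)) (span_basis e_basis) dimL.
  have szf' : size f == l by rewrite szf.
  exists (Tuple sze), (Tuple szf'); split=> //; apply/matrixP => i j.
  by rewrite !mxE /= (ef (cast_ord (esym (eqP sze)) i) (cast_ord (esym (eqP sze)) j)).
exists e, f; split; rewrite ?size_tuple // => i j.
have /matrixP/(_ i j) := ef.
by rewrite !mxE /=.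
Qed.

Variables (W L N : {vspace E}).
Hypotheses (W_nondeg : nondegenerate_on q W).
Hypotheses (L_iso : isotropic q L) (N_iso : isotropic q N).
Hypotheses (LN_span : (L + N)%VS = W) (LN_disj : (L :&: N)%VS = 0%VS).

Lemma gram_isotropic (V : {vspace E}) (m n : nat) (s : m.-tuple E) (t : n.-tuple E) :
  isotropic q V -> {subset s <= V} -> {subset t <= V} -> gram q s t = 0.
Proof.
move=> /orthovP V0 sV tV; apply/matrixP => i j; rewrite !mxE V0 //.
  by rewrite sV // mem_nth ?size_tuple.
by rewrite tV // mem_nth ?size_tuple.
Qed.

(** The component along L of any dual family can be discarded, because L is
isotropic. *)
Lemma exists_dual_lagrangian (l : nat) (e : l.-tuple E) : basis_of L e ->
  exists2 f : l.-tuple E, {subset f <= N} & gram q e f = 1%:M.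
Proof.
move=> e_basis; have eL v := @basis_mem _ _ v _ _ e_basis.
have [|f fW ef] := exists_dual W_nondeg _ (basis_free e_basis).
  by move=> v /eL vL; rewrite -LN_span (subvP (addvSl L N)).
exists [tuple of map (daddv_pi N L) f].
  by move=> _ /mapP[v _ ->]; exact: memv_pi.
rewrite -ef; apply/matrixP => i j; rewrite !mxE (nth_map 0) ?size_tuple //.
have fj : f`_j \in (N + L)%VS by rewrite addvC LN_span fW // mem_nth ?size_tuple.
rewrite -[in RHS](daddv_pi_add _ fj) 1?capvC // linearDr.
have /orthovP L0 := L_iso.
by rewrite [X in _ = _ + X]L0 ?addr0 ?memv_pi // eL // mem_nth ?size_tuple.
Qed.

(** A family dual to a basis is free. *)
Lemma leq_dim_lagrangian : (\dim L <= \dim N)%N.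
Proof.
have [f fN ef] := exists_dual_lagrangian (vbasisP L).
have f_free : free f.
  apply: (@free_gram _ _ q _ _ _ (vbasis L)).
  by rewrite gram_sym ef trmx1 row_free_unit unitmx1.
rewrite -[X in (X <= _)%N](size_tuple f) -(eqP f_free) dimvS //.
exact/span_subvP.
Qed.

Lemma lker_daddv_pi : (W :&: lker (daddv_pi L N))%VS = N.
Proof.
apply/vspaceP => v; rewrite memv_cap memv_ker -LN_span.
apply/andP/idP => [[vLN /eqP pv0]|vN].
  by rewrite -(daddv_pi_add LN_disj vLN) pv0 add0r memv_pi.
have vLN : v \in (L + N)%VS by apply: (subvP (addvSr L N)).
split=> //; have := daddv_pi_add LN_disj vLN.
rewrite (@daddv_pi_id _ _ N L) // 1?capvC //.
by move/eqP; rewrite -subr_eq0 addrK.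
Qed.

Lemma dim_capv_complement (A : {vspace E}) : (A <= W)%VS ->
  (\dim (A :&: N) + \dim (daddv_pi L N @: A) = \dim A)%N.
Proof.
move=> AW; rewrite -(limg_ker_dim (daddv_pi L N) A); congr (_ + _)%N.
by rewrite -[in LHS]lker_daddv_pi capvA (capv_idPl AW).
Qed.

(** The sign depends only on A, not on the basis e or on the dual family f.  With
A = L it says that all the choices allowed for L give the orientation of
e0 ++ f0. *)
Lemma top_wedge_isotropic (l : nat) (e0 f0 : l.-tuple E)
    (A : {vspace E}) (e f : l.-tuple E) :
  basis_of L e0 -> {subset f0 <= N} -> gram q e0 f0 = 1%:M ->
  basis_of W (e0 ++ f0) ->
  (A <= W)%VS -> isotropic q A ->
  basis_of A e -> {subset f <= W} -> gram q e f = 1%:M ->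
  top_wedge W (e ++ f) = (-1) ^+ \dim (A :&: N) * top_wedge W (e0 ++ f0).
Proof.
move=> e0_basis f0N ef0 b_basis AW A_iso e_basis fW ef.
pose b := [tuple of e0 ++ f0]; pose s := [tuple of e ++ f].
have [B defs] : exists B, s = lincomb B b.
  exists (\matrix_(i, j) coord b j s`_i); apply: lincomb_coord => v.
  rewrite (span_basis b_basis) mem_cat => /orP[/(basis_mem e_basis)/(subvP AW)//|].
  exact: fW.
have bb : gram q b b = block_mx 0 1%:M 1%:M 0.
  have e0L v : v \in e0 -> v \in L by apply: basis_mem e0_basis.
  rewrite gram_cat ef0 [gram q f0 e0]gram_sym ef0 trmx1.
  by rewrite [gram q e0 e0](gram_isotropic L_iso) // (gram_isotropic N_iso).
have ee : gram q e e = 0.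
  by apply: gram_isotropic A_iso _ _ => v; apply: basis_mem e_basis.
pose X := ulsubmx B; pose Y := ursubmx B; pose Z := dlsubmx B; pose U := drsubmx B.
have defB : B = block_mx X Y Z U by rewrite submxK.
have [XY XU] : X *m Y^T + Y *m X^T = 0 /\ X *m U^T + Y *m Z^T = 1%:M.
  have : gram q s s = gram q (lincomb B b) (lincomb B b) by rewrite -defs.
  rewrite gram_lincomb bb gram_cat defB tr_block_mx !mulmx_block.
  rewrite !mulmx0 !mulmx1 !add0r !addr0 => /eq_block_mx[+ + _ _].
  by rewrite ef ee => /esym XY /esym XU; rewrite addrC XY addrC XU.
have dimW : \dim W = (l + l)%N := size_basis (b_basis : basis_of W b).
rewrite -[e ++ f]/(tval s) defs (top_wedge_lincomb _ _ dimW) defB det_isotropic_block //.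
congr (_ ^+ _ * _).
have dimA : \dim A = l by apply: size_basis e_basis.
have dimA' := dim_capv_complement AW.
(* X is the matrix of the projection to L on A, and A meets N in its kernel. *)
suff <- : \dim (daddv_pi L N @: A) = \rank X by rewrite -[in LHS]dimA -dimA' addnK.
have <- := dim_span_lincomb X (basis_free e0_basis).
rewrite -(span_basis e_basis) limg_span; congr (\dim <<_>>).
suff <- : [tuple of map (daddv_pi L N) e] = lincomb X e0 by [].
apply: eq_from_nth_ord => i; rewrite nth_lincomb (nth_map 0) ?size_tuple //.
have -> : e`_i = s`_(lshift l i) by rewrite nth_cat size_tuple /= ltn_ord.
rewrite defs nth_lincomb linear_sum big_split_ord /=.
rewrite [X in _ + X]big1 ?addr0 => [|j _].
  apply: eq_bigr => j _; rewrite linearZ /= !mxE nth_cat size_tuple ltn_ord.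
  by rewrite daddv_pi_id // (basis_mem e0_basis) // mem_nth ?size_tuple.
rewrite nth_cat size_tuple ltnNge leq_addr /= addKn.
have : f0`_j \in (W :&: lker (daddv_pi L N))%VS.
  by rewrite lker_daddv_pi f0N // mem_nth ?size_tuple.
by rewrite memv_cap memv_ker => /andP[_ /eqP pf0]; rewrite linearZ /= pf0 scaler0.
Qed.

End HyperbolicSpaces.

Lemma dim_lagrangian (K : fieldType) (E : vectType K) (q : {symmetric E})
    (W L N : {vspace E}) :
  nondegenerate_on q W -> isotropic q L -> isotropic q N ->
  (L + N)%VS = W -> (L :&: N)%VS = 0%VS -> \dim L = \dim N.
Proof.
move=> W_nondeg L_iso N_iso LN_span LN_disj; apply/eqP; rewrite eqn_leq.
rewrite (leq_dim_lagrangian W_nondeg L_iso LN_span) //.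
by rewrite (leq_dim_lagrangian W_nondeg N_iso) // 1?capvC 1?addvC.
Qed.

(** The parity criterion for orientations, for a subspace A of half the dimension
and in terms of a complement of L.  Characteristic 2 has to be excluded, as the
two orientations coincide there. *)
Lemma same_orientationP (K : fieldType) (E : vectType K) (q : {symmetric E})
    (W L N A : {vspace E}) :
  2%:R != 0 :> K ->
  nondegenerate_on q W -> isotropic q L -> isotropic q N ->
  (L + N)%VS = W -> (L :&: N)%VS = 0%VS ->
  (A <= W)%VS -> isotropic q A -> \dim A = \dim L ->
  same_orientation q W A L <-> ~~ odd (\dim (A :&: N)).
Proof.
move=> two_neq0 W_nondeg L_iso N_iso LN_span LN_disj AW A_iso dimA.
have dimLN := dim_lagrangian W_nondeg L_iso N_iso LN_span LN_disj.
pose l := \dim L.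
have LW : (L <= W)%VS by rewrite -LN_span addvSl.
pose e0 := vbasis L; have e0_basis : basis_of L e0 := vbasisP L.
have [f0 f0N ef0] := exists_dual_lagrangian W_nondeg L_iso LN_span LN_disj e0_basis.
have f0_basis : basis_of N f0.
  rewrite basisEfree size_tuple -dimLN leqnn andbT; apply/andP; split.
    apply: (@free_gram _ _ q _ _ _ e0).
    by rewrite gram_sym ef0 trmx1 row_free_unit unitmx1.
  exact/span_subvP.
have b_basis : basis_of W (e0 ++ f0).
  by rewrite -LN_span; apply: cat_basis => //; apply/directv_addP.
have wedge := top_wedge_isotropic L_iso N_iso LN_span LN_disj e0_basis f0N ef0 b_basis.
pose w := top_wedge W (e0 ++ f0).
have w_neq0 : w != 0 by apply: (@top_wedge_neq0 _ _ W _ [tuple of e0 ++ f0]).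
have orL o : induces_orientation q W L o -> o = w.
  move=> /(@induces_orientationP _ _ _ _ _ _ l erefl)[e [f [e_basis fW ef ->]]].
  by rewrite (wedge _ _ _ LW L_iso e_basis fW ef) LN_disj dimv0 mul1r.
have orA o : induces_orientation q W A o -> o = (-1) ^+ \dim (A :&: N) * w.
  move=> /(@induces_orientationP _ _ _ _ _ _ l dimA)[e [f [e_basis fW ef ->]]].
  by rewrite (wedge _ _ _ AW A_iso e_basis fW ef).
split=> [[o /orA-> /orL /eqP]|AN_even].
  apply: contraTN => AN_odd; rewrite -signr_odd AN_odd expr1 mulN1r.
  by rewrite eq_sym -subr_eq0 opprK -mulr2n -mulr_natl mulf_neq0.
exists w; apply/(@induces_orientationP _ _ _ _ _ _ l) => //; last first.
  exists e0, f0; split=> // v /f0N vN.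
  by rewrite -LN_span (subvP (addvSr L N)).
pose e := tcast dimA (vbasis A).
have e_basis : basis_of A e by rewrite val_tcast vbasisP.
have [|f fW ef] := exists_dual W_nondeg _ (basis_free e_basis).
  by move=> v /(basis_mem e_basis)/(subvP AW).
exists e, f; split=> //.
by rewrite (wedge _ _ _ AW A_iso e_basis fW ef) -signr_odd (negbTE AN_even) mul1r.
Qed.

(** * Averages over the torus *)

Section TorusRepresentations.
Variables (R : realType) (r : nat).
Local Notation C := R[i].
Local Notation point := {ffun 'I_r -> C}.
Local Notation weight := {ffun 'I_r -> int}.

Definition character (x : weight) (t : point) : C := \prod_i t i ^ x i.

Definition torus_mul (s t : point) : point := [ffun i => s i * t i].

Lemma characterM (x : weight) (s t : point) :
  character x (torus_mul s t) = character x s * character x t.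
Proof.
rewrite /character -big_split; apply: eq_bigr => i _ /=.
by rewrite ffunE expfzMl.
Qed.

Lemma two_neq0 : 2%:R != 0 :> C.
Proof. by rewrite (pnatr_eq0 C). Qed.

(** A one-parameter subgroup in a direction where the exponent is non-zero,
evaluated at 2. *)
Lemma character_neq1 (x : weight) : x != 0 ->
  exists2 t, t \in torus R r & character x t != 1.
Proof.
move=> x_neq0; have [i xi_neq0] : exists i, x i != 0.
  apply/existsP; apply: contraNT x_neq0 => /existsPn x0.
  by apply/eqP/ffunP => i; rewrite ffunE; apply/eqP/negbNE.
exists [ffun j => if j == i then 2%:R else 1].
  apply/forallP => j; rewrite ffunE.
  by case: ifP => _; [exact: two_neq0 | exact: oner_neq0].
rewrite /character (bigD1 i) //= big1 => [|j /negbTE ji]; last first.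
  by rewrite ffunE ji exp1rz.
by rewrite ffunE eqxx mulr1 pexprz_eq1 ?ler0n // negb_or xi_neq0 pnatr_eq1.
Qed.

Lemma torus_mul_closed (s t : point) :
  s \in torus R r -> t \in torus R r -> torus_mul s t \in torus R r.
Proof.
move=> /forallP sT /forallP tT; apply/forallP => i.
by rewrite ffunE mulf_neq0.
Qed.

Lemma one_torus : [ffun=> 1] \in torus R r.
Proof. by apply/forallP => i; rewrite ffunE oner_neq0. Qed.

Lemma character1 (x : weight) : character x [ffun=> 1] = 1.
Proof. by rewrite /character big1 // => i _; rewrite ffunE exp1rz. Qed.

Lemma character0 (t : point) : character 0 t = 1.
Proof. by rewrite /character big1 // => i _; rewrite ffunE expr0z. Qed.

(** A finitely supported measure on the torus whose Fourier coefficients vanish at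
the non-zero weights of X and equal 1 at the weight 0.  Convolution multiplies
Fourier coefficients, so it suffices to kill one weight x at a time: the measure
(delta_t0 - x(t0) delta_1) / (1 - x(t0)) does it, for any t0 with
x(t0) <> 1. *)
Lemma exists_character_filter (X : seq weight) : exists w : seq (C * point),
  {in w, forall u, u.2 \in torus R r} /\
  {in 0 :: X, forall x, \sum_(u <- w) u.1 * character x u.2 = (x == 0)%:R}.
Proof.
elim: X => [|x X [w [wT wX]]].
  exists [:: (1, [ffun=> 1])]; split=> [u|x]; rewrite inE => /eqP->.
    exact: one_torus.
  by rewrite big_seq1 character0 mulr1 eqxx.
have [x0|x_neq0] := eqVneq x 0.
  exists w; split=> // y; rewrite x0 inE => yX; apply: wX.
  by case/predU1P: yX => [->|//]; rewrite mem_head.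
have [t0 t0T xt0] := character_neq1 x_neq0.
pose d : C := (1 - character x t0)^-1.
(* The convolution factor that kills the weight x. *)
pose v := [:: (d, t0); (- (character x t0 * d), [ffun=> 1])].
exists [seq (a.1 * b.1, torus_mul a.2 b.2) | a <- w, b <- v]; split.
  move=> _ /allpairsP[[a b] [/= aw bv ->]]; apply: torus_mul_closed; first exact: wT.
  by move: bv; rewrite /= !inE => /orP[] /eqP->; [exact: t0T | exact: one_torus].
have d_neq0 : 1 - character x t0 != 0 by rewrite subr_eq0 eq_sym.
have v_sum y : \sum_(b <- v) b.1 * character y b.2
    = d * (character y t0 - character x t0).
  by rewrite big_cons big_seq1 /= character1 mulr1 mulrBr [_ x t0 * d]mulrC.
have conv y : \sum_(u <- [seq (a.1 * b.1, torus_mul a.2 b.2) | a <- w, b <- v])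
    u.1 * character y u.2 =
    (\sum_(a <- w) a.1 * character y a.2) * \sum_(b <- v) b.1 * character y b.2.
  rewrite big_allpairs_dep mulr_suml; apply: eq_bigr => a _.
  rewrite mulr_sumr; apply: eq_bigr => b _ /=.
  by rewrite characterM mulrACA.
move=> y; rewrite conv v_sum !inE => /or3P[/eqP->|/eqP->|yX].
- by rewrite wX ?mem_head // eqxx mul1r character0 mulVf.
- by rewrite subrr !mulr0 (negbTE x_neq0).
rewrite wX ?inE ?yX ?orbT //; case: eqVneq => [->|_]; last exact: mul0r.
by rewrite character0 mul1r mulVf.
Qed.

(** The list w is a finitely supported measure on the torus, given by pairs of a
coefficient and a point. *)
Definition average (w : seq (C * point)) (V : vectType C) (rho : torus_rep r V) : 'End(V) :=
  \sum_(u <- w) u.1 *: rho u.2.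

Lemma averageE (w : seq (C * point)) (V : vectType C) (rho : torus_rep r V) (v : V) :
  average w rho v = \sum_(u <- w) u.1 *: rho u.2 v.
Proof.
by rewrite sum_lfunE; apply: eq_bigr => u _; rewrite scale_lfunE.
Qed.

Record averaging (w : seq (C * point)) : Prop := {
  averaging_torus : {in w, forall u, u.2 \in torus R r};
  averaging_mass : \sum_(u <- w) u.1 = 1 }.

Definition projects_to_fixed (w : seq (C * point)) (V : vectType C)
    (rho : torus_rep r V) : Prop :=
  forall v, average w rho v \in fixed rho fullv.

(** One measure serves both representations, so that the two averages commute with
equivariant maps between them.  Translating the average by s multiplies the
contribution of the weight x by x(s), and only the weight 0 contributes; hence
the average is fixed. *)
Lemma exists_reynolds (V W : vectType C) (rhoV : torus_rep r V) (rhoW : torus_rep r W) :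
  exists w, [/\ averaging w, projects_to_fixed w rhoV & projects_to_fixed w rhoW].
Proof.
have [XV [AV defV]] := tact_alg rhoV; have [XW [AW defW]] := tact_alg rhoW.
have [w [wT wX]] := exists_character_filter (XV ++ XW).
have proj (U : vectType C) (rho : torus_rep r U) (X : seq weight) (A : weight -> 'End(U)) :
    {in torus R r, forall t, rho t = \sum_(x <- X) character x t *: A x} ->
    {subset X <= XV ++ XW} -> projects_to_fixed w rho.
  move=> defr XS v; apply/mem_fixed; split; first exact: memvf.
  have rhoP s : s \in torus R r ->
      rho s (average w rho v) = \sum_(x <- X) (x == 0)%:R *: A x v.
    move=> sT; rewrite averageE linear_sum /=.
    transitivity (\sum_(u <- w) \sum_(x <- X)
        (character x s * (u.1 * character x u.2)) *: A x v).
      rewrite !big_seq; apply: eq_bigr => u /wT uT.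
      rewrite linearZ /= -[rho s _]comp_lfunE -tactM // defr; last exact: torus_mul_closed.
      rewrite sum_lfunE scaler_sumr; apply: eq_bigr => x _.
      by rewrite scale_lfunE scalerA characterM mulrCA.
    rewrite exchange_big !big_seq; apply: eq_bigr => x /XS xX /=.
    rewrite -scaler_suml -mulr_sumr wX ?inE ?xX ?orbT //.
    by case: eqP => [->|_]; rewrite ?character0 ?mul1r ?mulr0.
  by move=> t tT; rewrite rhoP // -(rhoP _ one_torus) tact1 lfunE.
exists w; split.
- split=> //; have := wX 0 (mem_head _ _); rewrite eqxx; apply: etrans.
  by apply: eq_bigr => u _; rewrite character0 mulr1.
- by apply: proj defV _ => x xX; rewrite mem_cat xX.
- by apply: proj defW _ => x xX; rewrite mem_cat xX orbT.
Qed.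

Section Averages.
Variables (w : seq (C * point)) (w_avg : averaging w).

(** The total mass is 1, so the difference is a combination of the differences
rho t v - v. *)
Lemma average_sub (V : vectType C) (rho : torus_rep r V) (I : {vspace V}) (v : V) :
  {in torus R r, forall t, rho t v - v \in I} -> average w rho v - v \in I.
Proof.
move=> vI; rewrite averageE -[X in _ - X]scale1r -(averaging_mass w_avg).
rewrite scaler_suml -sumrB big_seq; apply: memv_suml => u /(averaging_torus w_avg) uT.
by rewrite -scalerBr memvZ ?vI.
Qed.

Lemma average_fixed (V : vectType C) (rho : torus_rep r V) (v : V) :
  v \in fixed rho fullv -> average w rho v = v.
Proof.
move=> /mem_fixed[_ vT]; apply/eqP; rewrite -subr_eq0 -memv0.
by apply: average_sub => t /vT->; rewrite subrr mem0v.
Qed.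

Lemma average_stable (V : vectType C) (rho : torus_rep r V) (U : {vspace V}) (v : V) :
  tstable rho U -> v \in U -> average w rho v \in U.
Proof.
move=> U_stable vU; rewrite averageE big_seq.
apply: memv_suml => u /(averaging_torus w_avg) uT; rewrite memvZ //.
by rewrite (subvP (U_stable _ uT)) ?memv_img.
Qed.

Lemma average_equivariant (V W : vectType C) (rhoV : torus_rep r V)
    (rhoW : torus_rep r W) (f : 'Hom(V, W)) (v : V) :
  tequivariant rhoV rhoW f -> f (average w rhoV v) = average w rhoW (f v).
Proof.
move=> f_equiv; rewrite !averageE linear_sum !big_seq.
apply: eq_bigr => u /(averaging_torus w_avg)/f_equiv/lfunP/(_ v).
by rewrite !comp_lfunE linearZ /= => ->.
Qed.

(** The invariance of the form moves the action from y to the fixed vector x. *)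
Lemma average_adjoint (V : vectType C) (rho : torus_rep r V) (q : {symmetric V}) (x y : V) :
  {in torus R r, forall t (x y : V), q (rho t x) (rho t y) = q x y} ->
  x \in fixed rho fullv -> q x (average w rho y) = q x y.
Proof.
move=> q_inv /mem_fixed[_ xT]; rewrite averageE linear_sumr big_seq.
transitivity (\sum_(u <- w) u.1 * q x y).
  rewrite [RHS]big_seq; apply: eq_bigr => u /(averaging_torus w_avg) uT.
  by rewrite linearZr_LR /= -{1}(xT _ uT) q_inv.
by rewrite -mulr_suml (averaging_mass w_avg) mul1r.
Qed.
End Averages.

(** Exactness of fixed parts.  Averages lift a fixed class of U / f(V) to a fixed
vector of U, and a fixed vector of f(V) to a fixed vector of V: the preimage of
the fixed classes is U^T + f(V), and U^T meets f(V) in f(V^T). *)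
Lemma dim_coker_fixedE (V W : vectType C) (rhoV : torus_rep r V)
    (rhoW : torus_rep r W) (U : {vspace W}) (f : 'Hom(V, W)) :
  tequivariant rhoV rhoW f -> tstable rhoW U -> (limg f <= U)%VS ->
  dim_coker_fixed rhoW U f = (\dim (fixed rhoW U) - \dim (f @: fixed rhoV fullv))%N.
Proof.
move=> f_equiv U_stable fU.
have [w [w_avg wV wW]] := exists_reynolds rhoV rhoW.
have fixedE : fixed_mod rhoW U (limg f) = (fixed rhoW U + limg f)%VS.
  apply/vspaceP => v; apply/idP/memv_addP => [/mem_fixed_mod[vU vI]|].
    exists (average w rhoW v).
      apply/mem_fixed; split; first exact: average_stable.
      by have /mem_fixed[] := wW v.
    exists (v - average w rhoW v); last by rewrite addrC subrK.
    by rewrite -opprB memvN average_sub.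
  move=> [v1 /mem_fixed[v1U v1T] [v2 v2I ->]]; apply/mem_fixed_mod.
  split=> [|t tT]; first by rewrite memvD // (subvP fU).
  rewrite linearD /= v1T // opprD addrACA subrr add0r memvB //.
  have /memv_imgP[x _ ->] := v2I.
  by have /lfunP/(_ x) := f_equiv t tT; rewrite !comp_lfunE => <-; rewrite memv_img ?memvf.
have capE : (fixed rhoW U :&: limg f)%VS = (f @: fixed rhoV fullv)%VS.
  apply/vspaceP => v; rewrite memv_cap; apply/andP/memv_imgP.
    move=> [/mem_fixed[vU vT] /memv_imgP[x _ defv]].
    exists (average w rhoV x); first exact: wV.
    rewrite (average_equivariant w_avg _ f_equiv) -defv (average_fixed w_avg) //.
    by apply/mem_fixed; rewrite memvf.
  move=> [x /mem_fixed[_ xT] ->]; have fx := memv_img f (memvf x).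
  split=> //; apply/mem_fixed; split=> [|t tT]; first exact: (subvP fU).
  by have /lfunP/(_ x) := f_equiv t tT; rewrite !comp_lfunE xT.
rewrite /dim_coker_fixed fixedE -capE.
by rewrite -(addnK (\dim (fixed rhoW U :&: limg f)) (\dim _)) dimv_sum_cap subnAC addnK.
Qed.

Lemma daddv_pi_equivariant (V : vectType C) (rho : torus_rep r V) (L N : {vspace V}) :
  (L + N)%VS = fullv -> (L :&: N)%VS = 0%VS -> tstable rho L -> tstable rho N ->
  tequivariant rho rho (daddv_pi L N).
Proof.
move=> LN_span LN_disj L_stable N_stable t tT; apply/lfunP => v; rewrite !comp_lfunE.
have stab U x : tstable rho U -> x \in U -> rho t x \in U.
  by move=> U_stable xU; rewrite (subvP (U_stable t tT)) ?memv_img.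
have pN x : x \in N -> daddv_pi L N x = 0.
  move=> xN; apply/eqP; rewrite -memv_ker; move: x xN; apply/subvP.
  by rewrite -[X in (X <= _)%VS](lker_daddv_pi LN_span LN_disj) capvSr.
have /memv_addP[x xL [y yN ->]] : v \in (L + N)%VS by rewrite LN_span memvf.
by rewrite !linearD /= (pN _ yN) linear0
  (pN _ (stab _ _ N_stable yN)) !addr0 !daddv_pi_id ?stab.
Qed.

(** For fixed v, pairing v with x and with the average of x gives the same value,
so a fixed vector orthogonal to the fixed part is orthogonal to everything. *)
Lemma nondegenerate_on_fixed (V : vectType C) (rho : torus_rep r V) (q : {symmetric V}) :
  {in torus R r, forall t (x y : V), q (rho t x) (rho t y) = q x y} ->
  nondegenerate q -> nondegenerate_on q (fixed rho fullv).
Proof.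
move=> q_inv /eqP q_nondeg v v_fixed v_orth.
have [w [w_avg wV _]] := exists_reynolds rho rho.
apply/eqP; rewrite -memv0 -q_nondeg; apply/mem_orthovP => x _.
by rewrite -(average_adjoint w_avg _ q_inv v_fixed) v_orth.
Qed.

End TorusRepresentations.

(** If a x = 0 then every functional q(e, a(-)) vanishes at x, and by hypothesis
these are all the functionals on Ff. *)
Lemma obstruction_theory_inj (K : fieldType) (F E : vectType K) (q : {symmetric E})
    (a : 'Hom(F, E)) (Ff : {vspace F}) (Ef : {vspace E}) :
  point_obstruction_theory q a Ff Ef -> (Ff :&: lker a)%VS = 0%VS.
Proof.
move=> [_ _ surj]; apply/eqP; rewrite -subv0; apply/subvP => x.
rewrite memv_cap memv_ker memv0 => /andP[xFf /eqP ax0].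
rewrite (coord_vbasis (memvf x)) big1 // => i _.
have [e _ e_phi] := surj (linfun (coord (vbasis fullv) i : F -> K^o)).
by have := e_phi x xFf; rewrite ax0 linear0r lfunE /= => <-; rewrite scale0r.
Qed.

Lemma natr_Z2 (n : nat) : n%:R = (odd n)%:R :> 'Z_2.
Proof.
rewrite -[in LHS](odd_double_half n) natrD -mul2n natrM.
by rewrite (_ : 2%:R = 0 :> 'Z_2) ?mul0r ?addr0 //; apply: val_inj.
Qed.

Theorem proposition2p29 (R : realType) (r : nat) (F E : vectType R[i])
    (rhoF : torus_rep r F) (rhoE : torus_rep r E)
    (q : {symmetric E}) (a : 'Hom(F, E)) (L N : {vspace E})
    (q_nondeg : nondegenerate q)
    (q_inv : {in torus R r, forall t (x y : E), q (rhoE t x) (rhoE t y) = q x y})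
    (E_even : ~~ odd (\dim {:E}))
    (a_equiv : tequivariant rhoF rhoE a)
    (a_complex : is_sym_complex q a)
    (L_stable : tstable rhoE L) (L_max : max_isotropic q fullv L)
    (N_stable : tstable rhoE N) (N_max : max_isotropic q fullv N)
    (LN_span : (L + N)%VS = fullv) (LN_disj : (L :&: N)%VS = 0%VS)
    (P_obs : point_obstruction_theory q a (fixed rhoF fullv) (fixed rhoE fullv))
    (P_vd : virtual_dim (fixed rhoF fullv) (fixed rhoE fullv) = 0) :
  orientation_parity q (fixed rhoE fullv) (fixed rhoE L) (a @: fixed rhoF fullv)
  = (dim_coker_fixed rhoE L (daddv_pi L N \o a)%VF)%:R :> 'Z_2.
Proof.
set Ff := fixed rhoF fullv in P_obs P_vd *; set Ef := fixed rhoE fullv in P_obs P_vd *.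
set Lf := fixed rhoE L; set p := daddv_pi L N; set A := (a @: Ff)%VS.
pose Nf := fixed rhoE N.
have p_equiv : tequivariant rhoE rhoE p by exact: daddv_pi_equivariant.
have [AEf aa0 _] := P_obs.
have A_iso : isotropic q A.
  by apply/orthovP => _ _ /memv_imgP[x xF ->] /memv_imgP[y yF ->]; apply: aa0.
have fixed_iso (U : {vspace E}) : max_isotropic q fullv U -> isotropic q (fixed rhoE U).
  move=> [_ /orthovP U0 _]; apply/orthovP => x y /mem_fixed[xU _] /mem_fixed[yU _].
  exact: U0.
have sub_fixed (U : {vspace E}) : (fixed rhoE U <= Ef)%VS.
  by apply/subvP => v /mem_fixed[_ vT]; apply/mem_fixed; rewrite memvf.
have Ef_nondeg : nondegenerate_on q Ef by exact: nondegenerate_on_fixed.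
(* The two components of a fixed vector are fixed, by equivariance of p. *)
have LNf_span : (Lf + Nf)%VS = Ef.
  apply/eqP; rewrite eqEsubv subv_add !sub_fixed /=; apply/subvP => v /mem_fixed[_ vT].
  have vLN : v \in (L + N)%VS by rewrite LN_span memvf.
  have pvT : {in torus R r, forall t, rhoE t (p v) = p v}.
    by move=> t tT; rewrite -comp_lfunE -p_equiv // comp_lfunE vT.
  rewrite -(daddv_pi_add LN_disj vLN); apply: memv_add; apply/mem_fixed.
    by split; first exact: memv_pi.
  split=> [|t tT]; first exact: memv_pi.
  have -> : daddv_pi N L v = v - p v.
    by rewrite -[X in X - _](daddv_pi_add LN_disj vLN) addrC addKr.
  by rewrite linearB /= vT // pvT.
have LNf_disj : (Lf :&: Nf)%VS = 0%VS.
  apply/eqP; rewrite -subv0 -LN_disj; apply/subvP => v.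
  by rewrite !memv_cap => /andP[/mem_fixed[-> _] /mem_fixed[-> _]].
have dimLN := dim_lagrangian Ef_nondeg (fixed_iso L L_max) (fixed_iso N N_max) LNf_span LNf_disj.
have dimEf : \dim Ef = (\dim Lf + \dim Lf)%N.
  by rewrite -LNf_span dimv_disjoint_sum // dimLN.
have dimA : \dim A = \dim Lf.
  rewrite (limg_dim_eq (obstruction_theory_inj P_obs)).
  move/eqP: P_vd; rewrite /virtual_dim dimEf addnn -mul2n natrM mulrAC mulfV ?mul1r //.
  by rewrite subr_eq0 eqr_nat => /eqP.
(* By exactness of fixed parts the cokernel is that of the projection A -> L^f,
   which has the dimension of the kernel as A and L^f have equal dimensions. *)
have coker : dim_coker_fixed rhoE L (p \o a)%VF = \dim (A :&: Nf).
  rewrite (dim_coker_fixedE (rhoV := rhoF)) //; first last.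
  - by apply/subvP => _ /memv_imgP[x _ ->]; rewrite comp_lfunE memv_pi.
  - by move=> t tT; rewrite -comp_lfunA a_equiv // comp_lfunA p_equiv // comp_lfunA.
  rewrite limg_comp -/A -/Lf -dimA.
  rewrite -(dim_capv_complement LN_span LN_disj (subvf A)) addnK.
  congr (\dim _); apply/vspaceP => v; rewrite !memv_cap.
  apply/andP/andP => -[vA]; last by move=> /mem_fixed[].
  move=> vN; split=> //; apply/mem_fixed; split=> //.
  by have /mem_fixed[] := subvP AEf _ vA.
have parity : same_orientation q Ef A Lf <-> ~~ odd (\dim (A :&: Nf)).
  by apply: same_orientationP; rewrite ?two_neq0 //; exact: fixed_iso.
rewrite coker natr_Z2 /orientation_parity.
by case: asboolP; [move=> /parity/negbTE-> | move=> /parity/negP/negPn->].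
Qed.
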